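(* Let $N\geq3$, $q>1^{\ast\ast}:=\frac N{N-2}$, and $$\widetilde K:=\inf\{\lVert u\rVert_{\widetilde D^{2,1}(\mathbb Z^N)}:u\in\widetilde D^{2,1}(\mathbb Z^N),\ \lVert u\rVert_{\ell^q(\mathbb Z^N)}=1\}.$$ Let $\{u_n\}\subset\widetilde D^{2,1}(\mathbb Z^N)$ be a minimizing sequence, i.e. $\lVert u_n\rVert_{\ell^q(\mathbb Z^N)}=1$ for all $n$ and $\lVert u_n\rVert_{\widetilde D^{2,1}(\mathbb Z^N)}\to\widetilde K$ as $n\to\infty$. Then there exist a sequence $\{x_n\}\subset\mathbb Z^N$ and $v\in\widetilde D^{2,1}(\mathbb Z^N)$ such that the translated sequence $v_n(x):=u_n(x_n+x)$ contains a subsequence converging to $v$ in $\widetilde D^{2,1}(\mathbb Z^N)$ (i.e. in the norm $\lVert\cdot\rVert_{\widetilde D^{2,1}(\mathbb Z^N)}$). Moreover, $v$ is a minimizer for $\widetilde K$, i.e. $\lVert v\rVert_{\ell^q(\mathbb Z^N)}=1$ and $\lVert v\rVert_{\widetilde D^{2,1}(\mathbb Z^N)}=\widetilde K$.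
   Context: $\mathbb Z^N$ is the integer lattice graph: $x\sim y$ iff $\sum_{i=1}^N|x_i-y_i|=1$, i.e. the Cayley graph with generating set $S=\{s_1,\dots,s_m\}$, $m=2N$, consisting of the vectors $\pm e_k$ ($e_k$ the standard basis). For $u:\mathbb Z^N\to\mathbb R$: $\partial_iu(x):=u(x+s_i)-u(x)$, $\lVert u\rVert_{\widetilde D^{2,1}(\mathbb Z^N)}:=\sum_{i,j=1}^m\sum_{x\in\mathbb Z^N}|\partial_j\partial_iu(x)|$, and $\widetilde D^{2,1}(\mathbb Z^N):=\{u\in\ell^{\frac N{N-2}}(\mathbb Z^N):\lVert u\rVert_{\widetilde D^{2,1}(\mathbb Z^N)}<\infty\}$. *)

(* Defs.v *)
(* MathComp-Analysis. *)
From HB Require Import structures.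
From mathcomp Require Import all_boot all_order all_algebra.
From mathcomp Require Import all_classical all_reals all_analysis.

Set Implicit Arguments.
Unset Strict Implicit.
Unset Printing Implicit Defensive.

Import Order.TTheory GRing.Theory Num.Theory.
Import numFieldNormedType.Exports.

Local Open Scope classical_set_scope.
Local Open Scope ring_scope.

(* The m = 2N generators are indexed by ('I_N * bool):
   (k, false) is e_k and (k, true) is - e_k. *)
Definition lat_gen (N : nat) (s : 'I_N * bool) : 'rV[int]_N :=
  (-1) ^+ s.2 *: delta_mx 0 s.1.

Definition lat_diff (R : realType) (N : nat) (s : 'I_N * bool)
    (u : 'rV[int]_N -> R) : 'rV[int]_N -> R :=
  fun x => u (x + lat_gen s) - u x.

(* Norms take values in [0, +oo]; they are +oo when the series diverges. *)
Definition lnorm (R : realType) (N : nat) (p : R) (u : 'rV[int]_N -> R) :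
    \bar R :=
  poweR (\esum_(x in [set: 'rV[int]_N]) (`|u x| `^ p)%:E) p^-1.

Definition D21norm (R : realType) (N : nat) (u : 'rV[int]_N -> R) : \bar R :=
  (\sum_(i : 'I_N * bool) \sum_(j : 'I_N * bool)
     \esum_(x in [set: 'rV[int]_N]) `|lat_diff j (lat_diff i u) x|%:E)%E.

(* 1^** = N / (N - 2), with real (not truncated) subtraction. *)
Definition crit_exp (R : realType) (N : nat) : R := N%:R / (N%:R - 2).

Definition D21 (R : realType) (N : nat) : set ('rV[int]_N -> R) :=
  [set u | (lnorm (crit_exp R N) u < +oo)%E /\ (D21norm u < +oo)%E].

Definition Ktilde (R : realType) (N : nat) (q : R) : \bar R :=
  ereal_inf [set D21norm u | u in [set u : 'rV[int]_N -> R |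
    D21 u /\ lnorm q u = 1%E]].

(* Main.v *)
Require Import Defs.
From HB Require Import structures.
From mathcomp Require Import all_boot all_order all_algebra.
From mathcomp Require Import all_classical all_reals all_analysis.
From mathcomp Require Import lra.
Set Implicit Arguments.
Unset Strict Implicit.
Unset Printing Implicit Defensive.
Import Order.TTheory GRing.Theory Num.Theory.
Import numFieldNormedType.Exports.
Local Open Scope classical_set_scope.
Local Open Scope ring_scope.

(** The proof is the direct method, with compactness recovered by translation.

    Write p for the critical exponent N / (N - 2), D for the second-order norm
    and K for the infimum. The analytic input is the Sobolev inequality
    [sobolev]: the l^p norm of u is at most D u, with constant 1. Since p < q,
    it has two consequences. First, K >= 1 ([Ktilde_ge1]). Second, a sequence
    with unit l^q norm and bounded D cannot be uniformly small
    ([nonvanishing]), because the sum of |u|^q is at most (sup |u|)^(q - p)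
    times the sum of |u|^p. So each u_n, for n large, can be translated to make
    it at least c > 0 in modulus at the origin, and every pointwise limit v of
    the translates w_n is nonzero. By lower semicontinuity v lies in the space,
    and a, the sum of |v|^q, satisfies 0 < a <= 1.

    It remains to show that no mass escapes. Pointwise convergence splits both
    functionals asymptotically (in the manner of Brezis and Lieb):
    D (w_n - v) + D v <= D w_n + o(1) ([near_D21norm_split]), and the sum of
    |w_n - v|^q is at least 1 - a - o(1) ([near_lpsum_split]). As
    D >= K * (l^q norm) on the space ([Ktilde_le]), in the limit
    a^(1/q) + (1 - a)^(1/q) <= 1, which for q > 1 and 0 < a <= 1 forces a = 1
    ([no_dichotomy]). Then D v >= K, so D (w_n - v) tends to 0 and D v = K.

    The Sobolev inequality is proved in the manner of Gagliardo and Nirenberg.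
    Telescoping twice along e_k and e_l bounds |u x| by the sum of
    |d_l d_k u| over the coordinate plane through x in the directions k and l
    ([normr_le_esum_slice2]). Take the N planes spanned by cyclically
    consecutive directions and multiply the N bounds, each raised to the power
    1 / (N - 2). A given direction is missed by exactly N - 2 of these planes,
    which is the covering condition of Finner's extension of the Loomis-Whitney
    inequality ([esum_finner]). The N exponents add up to N / (N - 2) = p.

    Limits are taken along an ultrafilter U on the integers finer than the
    Frechet filter. Along U every bounded real sequence converges, so the
    pointwise limit v exists at every site at once. A subsequence appears only
    at the end: every member of U is infinite, so a statement true
    U-almost everywhere holds at arbitrarily large indices
    ([extract_subseq]). *)

(** * Series of nonnegative terms and Hoelder's inequality *)

Lemma esumZ (R : realType) (T : choiceType) (S : set T) (c : R)
    (a : T -> \bar R) : 0 <= c -> (forall t, (0 <= a t)%E) ->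
  (\esum_(t in S) (c%:E * a t) = c%:E * \esum_(t in S) a t)%E.
Proof.
have le (c' : R) (b : T -> \bar R) : 0 < c' -> (forall t, (0 <= b t)%E) ->
    (\esum_(t in S) (c'%:E * b t) <= c'%:E * \esum_(t in S) b t)%E.
  move=> c0 b0; apply: ge_ereal_sup => _ [A [finA AS] <-].
  rewrite -ge0_mule_fsumr// lee_pmul2l ?lte_fin//.
  by apply: esum_ge; exists A.
move=> + a0; rewrite le_eqVlt => /predU1P[<-|c0].
  by rewrite mul0e esum1// => t _; rewrite mul0e.
apply/eqP; rewrite eq_le le//=.
rewrite -lee_pdivlMl//.
apply: le_trans (le c^-1 (fun t => c%:E * a t)%E _ _).
- by apply: le_esum => t _; rewrite muleA -EFinM mulVf ?gt_eqF// mul1e.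
- by rewrite invr_gt0.
- by move=> t; rewrite mule_ge0// lee_fin ltW.
Qed.

Lemma esum_sup1 (R : realType) (T : choiceType) (S : set T) (a : T -> \bar R)
    (t : T) : (forall t, (0 <= a t)%E) -> S t -> (a t <= \esum_(t in S) a t)%E.
Proof.
move=> a0 St; apply: esum_ge; exists [set t]; last by rewrite fsbig_set1.
by split=> // _ ->.
Qed.

Lemma le_esum_sub (R : realType) (T : choiceType) (S S' : set T)
    (a : T -> \bar R) : S `<=` S' ->
  (\esum_(t in S) a t <= \esum_(t in S') a t)%E.
Proof.
move=> SS'; apply: ge_ereal_sup => _ [A [finA AS] <-].
by apply: esum_ge; exists A => //; split=> //; exact: subset_trans SS'.
Qed.

Lemma fin_num_esum (R : realType) (T : choiceType) (S : set T)
    (a : T -> R) : (forall t, 0 <= a t) ->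
  (\esum_(t in [set: T]) (a t)%:E < +oo)%E ->
  (\esum_(t in S) (a t)%:E)%E \is a fin_num.
Proof.
move=> a0 afin.
rewrite ge0_fin_numE ?esum_ge0// => [|t _]; last by rewrite lee_fin.
by apply: le_lt_trans afin; exact: le_esum_sub.
Qed.

(** The inequality between the geometric and arithmetic means, in the root form
    needed to sum it over t below. *)
Lemma prod_powR_le_mean (R : realType) (I : finType) (A : {pred I})
    (a : I -> R) : (0 < #|A|)%N -> (forall i, 0 <= a i) ->
  \prod_(i in A) a i `^ #|A|%:R^-1 <= #|A|%:R^-1 * \sum_(i in A) a i.
Proof.
move=> A0 a0; set n := #|A|.
have n0 : n%:R != 0 :> R by rewrite pnatr_eq0 -lt0n.
have s0 : 0 <= \sum_(i in A) (a i / n%:R).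
  by apply: sumr_ge0 => i _; rewrite divr_ge0.
have -> : n%:R^-1 * \sum_(i in A) a i = \sum_(i in A) (a i / n%:R).
  by rewrite mulr_sumr; apply: eq_bigr => i _; rewrite mulrC.
have := @leif_AGM_scaled R I A (fun i => a i / n%:R).
have h : {in A, forall i, 0 <= a i / n%:R *+ n}.
  by move=> i _; rewrite mulrn_wge0// divr_ge0.
move=> /(_ h)[le _].
have -> : \prod_(i in A) a i `^ n%:R^-1 =
    (\prod_(i in A) (a i / n%:R *+ n)) `^ n%:R^-1.
  have -> : \prod_(i in A) (a i / n%:R *+ n) = \prod_(i in A) a i.
    by apply: eq_bigr => i _; rewrite -[_ *+ n]mulr_natr divfK.
  suff [] : \prod_(i in A) a i `^ n%:R^-1 = (\prod_(i in A) a i) `^ n%:R^-1 /\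
      0 <= \prod_(i in A) a i by [].
  elim/big_rec2: _ => [|i y x _ [-> y0]]; first by rewrite powR1.
  by rewrite powRM// mulr_ge0.
apply: le_trans (ge0_ler_powR _ _ _ le) _.
- by rewrite invr_ge0.
- by rewrite nnegrE prodr_ge0// => i _; rewrite mulrn_wge0// divr_ge0.
- by rewrite nnegrE exprn_ge0.
- by rewrite -powR_mulrn// -powRrM mulfV// powRr1.
Qed.

(** Divide each f i by its total s i: the mean inequality bounds the normalized
    product pointwise by the average of the #|A| normalized functions, each of
    total 1. If some total vanishes, so does the whole product. *)
Lemma esum_holder (R : realType) (I : finType) (A : {pred I}) (T : choiceType)
    (f : I -> T -> R) : (0 < #|A|)%N -> (forall i t, 0 <= f i t) ->
  (forall i, i \in A -> \esum_(t in [set: T]) (f i t)%:E < +oo)%E ->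
  (\esum_(t in [set: T]) (\prod_(i in A) f i t `^ #|A|%:R^-1)%:E
   <= (\prod_(i in A) fine (\esum_(t in [set: T]) (f i t)%:E)
        `^ #|A|%:R^-1)%:E)%E.
Proof.
move=> A0 f0 ffin; set n := #|A|.
pose s i := fine (\esum_(t in [set: T]) (f i t)%:E)%E.
have sE i : i \in A -> (\esum_(t in [set: T]) (f i t)%:E)%E = (s i)%:E.
  by move=> iA; rewrite fineK// fin_num_esum// ffin.
have n0 : n%:R != 0 :> R by rewrite pnatr_eq0 -lt0n.
have s0 i : 0 <= s i by apply/fine_ge0/esum_ge0 => t _; rewrite lee_fin.
have fs i t : i \in A -> f i t <= s i.
  move=> iA; rewrite -lee_fin -sE//.
  apply: (@esum_sup1 R T setT (fun t => (f i t)%:E) t) => // t'.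
  by rewrite lee_fin.
have [[i iA si0]|spos] := pselect (exists2 i, i \in A & s i = 0).
  have fi0 t : f i t = 0 by apply/eqP; rewrite eq_le f0 -[X in _ <= X]si0 fs.
  rewrite esum1 => [|t _].
    by rewrite lee_fin prodr_ge0// => *; rewrite powR_ge0.
  by rewrite (bigD1 i)//= fi0 powR0 ?mul0r// invr_eq0.
have {spos}sgt0 i : i \in A -> 0 < s i.
  move=> iA; rewrite lt_neqAle s0 andbT eq_sym.
  by apply/eqP => si0; apply: spos; exists i.
set P := \prod_(i in A) s i `^ n%:R^-1.
have P0 : 0 < P by apply: prodr_gt0 => i iA; rewrite powR_gt0// sgt0.
pose m t := \sum_(i in A) f i t / s i.
have m0 t : 0 <= m t by apply: sumr_ge0 => i _; rewrite divr_ge0.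
apply: (@le_trans _ _ (\esum_(t in [set: T]) ((P / n%:R)%:E * (m t)%:E))%E).
  apply: le_esum => t _; rewrite -EFinM lee_fin -mulrA.
  have mean := @prod_powR_le_mean R I A (fun i => f i t / s i) A0.
  apply: le_trans (ler_wpM2l (ltW P0) (mean _)).
    rewrite -/n /P -big_split/=; apply: ler_prod => i iA; rewrite powR_ge0/=.
    by rewrite -powRM ?divr_ge0// mulrC divfK// gt_eqF// sgt0.
  by move=> i; rewrite divr_ge0.
rewrite esumZ ?divr_ge0 ?(ltW P0)//.
have -> : (\esum_(t in [set: T]) (m t)%:E)%E = n%:R%:E.
  under eq_esum do rewrite -sumEFin.
  rewrite esum_sum => [|t i _ _]; last by rewrite lee_fin divr_ge0.
  rewrite (eq_bigr (fun=> 1%E)) => [|i iA]; last first.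
    under eq_esum do rewrite mulrC EFinM.
    rewrite esumZ ?invr_ge0// => [|t]; last by rewrite lee_fin.
    by rewrite sE// -EFinM mulVf// gt_eqF// sgt0.
  by rewrite -[in RHS]sumr_const -sumEFin.
by rewrite -EFinM divfK.
Qed.

(** * Coordinate slices and Finner's inequality *)

Definition along (N : nat) (k : 'I_N) (x : 'rV[int]_N) (t : int) :
    'rV[int]_N :=
  x + t *: delta_mx 0 k.

(** The coset of x modulo the coordinate sublattice spanned by the directions
    in S. Sums over slices play the role of partial integrals: the sum over
    slice S x depends only on the coordinates of x outside S. *)
Definition slice (N : nat) (S : {set 'I_N}) (x : 'rV[int]_N) :
    set 'rV[int]_N :=
  [set y | forall j, j \notin S -> y 0 j = x 0 j].

Lemma slice0 N (x : 'rV[int]_N) : slice finset.set0 x = [set x].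
Proof.
apply/seteqP; split=> [y yx|y ->//].
by apply/rowP => j; apply: yx; rewrite inE.
Qed.

Lemma sliceT N (x : 'rV[int]_N) : slice [set: 'I_N]%SET x = setT.
Proof. by apply/seteqP; split=> // y _ j; rewrite inE. Qed.

Lemma slice_shift N (S : {set 'I_N}) k (t : int) (x : 'rV[int]_N) :
  k \in S -> slice S (along k x t) = slice S x.
Proof.
move=> kS; apply/seteqP; split=> y yx j jS; rewrite yx// /along !mxE;
  by case: (eqVneq j k) jS => [->|_ _]; rewrite ?kS// andbF mulr0 addr0.
Qed.

(** Fubini for one direction: a slice in the directions k |: S is the disjoint
    union of the slices in the directions S through the points of a line. *)
Lemma esum_slice_setU1 (R : realType) N (S : {set 'I_N}) k
    (f : 'rV[int]_N -> \bar R) (x : 'rV[int]_N) :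
  k \notin S -> (forall y, (0 <= f y)%E) ->
  (\esum_(y in slice (k |: S) x) f y =
   \esum_(t in [set: int]) \esum_(y in slice S (along k x t)) f y)%E.
Proof.
move=> kS f0.
rewrite esum_esum//; apply: reindex_esum; split=> [[t y] [_ /= yx] j||y yx].
- rewrite !inE negb_or => /andP[jk jS].
  by rewrite yx// /along !mxE (negPf jk) andbF mulr0 addr0.
- move=> [s y] [t z] /set_mem[_ /= ys] /set_mem[_ /= yt] /= yz.
  move: (ys _ kS) (yt _ kS); rewrite -yz /along !mxE !eqxx/= !mulr1 => -> /eqP.
  by rewrite (inj_eq (addrI _)) => /eqP ->.
- exists (y 0 k - x 0 k, y) => //; split=> // j jS.
  rewrite /along !mxE eqxx/=; case: (eqVneq j k) => [->|jk].
    by rewrite mulr1 addrC subrK.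
  by rewrite mulr0 addr0 yx// !inE negb_or jk.
Qed.

(** Finner's inequality for coordinate slices. Each factor is a function of
    the coordinates outside Z i, and every direction k lies outside exactly n
    of the sets Z i. Summing in the direction k therefore involves n factors
    raised to the power 1/n, to which Hoelder applies, while the remaining
    factors are constant in that direction. The induction sums over the
    directions of S one at a time. *)
Lemma esum_finner (R : realType) N (I : finType) (Z : I -> {set 'I_N}) (n : nat)
    (g : I -> 'rV[int]_N -> R) : (0 < n)%N ->
  (forall k, #|[pred i | k \notin Z i]| = n) -> (forall i y, 0 <= g i y) ->
  (forall i, \esum_(y in [set: 'rV[int]_N]) (g i y)%:E < +oo)%E ->
  forall S x,
  (\esum_(y in slice S x)
     (\prod_i fine (\esum_(z in slice (Z i) y) (g i z)%:E) `^ n%:R^-1)%:E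
   <= (\prod_i fine (\esum_(z in slice (S :|: Z i) x) (g i z)%:E)
        `^ n%:R^-1)%:E)%E.
Proof.
move=> n0 Zn g0 gfin S; have [m] := ubnP #|S|; elim: m S => // m IHm S Sm x.
have [->|[k kS]] := set_0Vmem S.
  rewrite slice0 esum_set1; last first.
    by rewrite lee_fin prodr_ge0// => *; rewrite powR_ge0.
  by under [in leRHS]eq_bigr do rewrite finset.set0U.
pose S' := S :\ k; have kS' : k \notin S' by rewrite !inE eqxx.
have SE : S = k |: S' by rewrite finset.setD1K.
rewrite {1}SE esum_slice_setU1//; last first.
  by move=> y; rewrite lee_fin prodr_ge0// => *; rewrite powR_ge0.
pose F i t := fine (\esum_(z in slice (S' :|: Z i) (along k x t))
  (g i z)%:E).
have F0 i t : 0 <= F i t by apply/fine_ge0/esum_ge0 => z _; rewrite lee_fin.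
have FE i : k \notin Z i -> (\esum_(t in [set: int]) (F i t)%:E =
    \esum_(z in slice (S :|: Z i) x) (g i z)%:E)%E.
  move=> kZ; rewrite SE -finset.setUA esum_slice_setU1.
  - by apply: eq_esum => t _; rewrite fineK// fin_num_esum.
  - by rewrite inE negb_or kS'.
  - by move=> y; rewrite lee_fin.
have Fk i t : k \in Z i ->
    F i t = fine (\esum_(z in slice (S :|: Z i) x) (g i z)%:E).
  move=> kZ; have kSZ : k \in S' :|: Z i by rewrite inE kZ orbT.
  rewrite /F (slice_shift t x kSZ).
  suff -> : S :|: Z i = S' :|: Z i by [].
  by apply/setP => j; rewrite !inE; case: eqVneq => // ->; rewrite kZ orbT.
apply: (@le_trans _ _ (\esum_(t in [set: int])
    (\prod_i F i t `^ n%:R^-1)%:E)%E).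
  apply: le_esum => t _; apply: IHm.
  by move: Sm; rewrite (cardsD1 k S) kS.
(* The factors with k in Z i come out of the sum over t; w i is their value. *)
clearbody F.
pose w i := fine (\esum_(z in slice (S :|: Z i) x) (g i z)%:E) `^ n%:R^-1.
rewrite -/(\prod_i w i).
have w0 i : 0 <= w i by rewrite powR_ge0.
have FM t : \prod_i F i t `^ n%:R^-1 = \prod_(i | k \in Z i) w i *
    \prod_(i in [pred i | k \notin Z i]) F i t `^ n%:R^-1.
  rewrite (bigID (fun i => k \in Z i))/=; congr (_ * _).
  by apply: eq_bigr => i kZ; rewrite /w Fk.
rewrite (@eq_esum _ _ _ _ (fun t => ((\prod_(i | k \in Z i) w i)%:E *
  (\prod_(i in [pred i | k \notin Z i]) F i t `^ n%:R^-1)%:E)%E)); last first.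
  by move=> t _; rewrite FM EFinM.
rewrite esumZ ?prodr_ge0//; last first.
  by move=> t; rewrite lee_fin prodr_ge0// => *; rewrite powR_ge0.
have := @esum_holder R I [pred i | k \notin Z i] _ F.
rewrite Zn => /(_ n0 F0 _)/wrap[i|].
  rewrite inE => kZ; rewrite FE// -ge0_fin_numE ?fin_num_esum//.
  by apply: esum_ge0 => *; rewrite lee_fin.
move=> le; apply: le_trans (lee_wpmul2l _ le) _.
  by rewrite lee_fin prodr_ge0.
rewrite -EFinM lee_fin [leRHS](bigID (fun i => k \in Z i))/=.
rewrite le_eqVlt; apply/predU1P; left; congr (_ * _).
by apply: eq_bigr => i kZ; rewrite /w FE.
Qed.

(** * Telescoping *)

(** A summable family takes arbitrarily small values along any sequence of
    distinct indices. This is the form of decay at infinity that telescoping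
    needs. *)
Lemma esum_inj_small (R : realType) (T : choiceType) (a : T -> R) (e : nat -> T)
    (eps : R) : (forall t, 0 <= a t) ->
  (\esum_(t in [set: T]) (a t)%:E < +oo)%E -> injective e -> 0 < eps ->
  exists n, a (e n) < eps.
Proof.
move=> a0 afin einj eps0; apply: contrapT => /forallNP ge.
have {}ge n : eps <= a (e n) by rewrite leNgt; apply/negP/ge.
have sumE := fineK (fin_num_esum setT a0 afin).
set s := fine _ in sumE.
have [M] : exists M : nat, s < M%:R * eps.
  exists (Num.truncn (s / eps)).+1; rewrite -ltr_pdivrMr//.
  exact: truncnS_gt.
apply/negP; rewrite -leNgt -lee_fin sumE.
apply: esum_ge; exists [set e i | i in `I_M].
  by split=> //; exact/finite_image/finite_II.
rewrite fsbig_image; last first.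
  by move=> i j _ _ /einj.
rewrite -fsbig_ord sumEFin lee_fin mulr_natl -[M in eps *+ M]card_ord -sumr_const.
by apply: ler_sum => i _.
Qed.

(** Telescoping along the half-line from x in the direction e_k: f x plus
    the sum of its first increments is the value of f at a later point of the
    half-line, which can be chosen where f is as small as desired. *)
Lemma normr_le_esum_diff (R : realType) N (k : 'I_N) (f : 'rV[int]_N -> R)
    (p : R) (x : 'rV[int]_N) : 0 < p ->
  (\esum_(y in [set: 'rV[int]_N]) (`|f y| `^ p)%:E < +oo)%E ->
  (`|f x|%:E <=
   \esum_(y in slice [set k]%SET x) `|lat_diff (k, false) f y|%:E)%E.
Proof.
move=> p0 fp; apply/lee_addgt0Pr => eps eps0.
pose e (n : nat) := along k x n%:Z.
have einj : injective e.
  move=> m n /rowP/(_ k); rewrite /e /along !mxE !eqxx/= !mulr1 => /addrI.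
  by case.
have [||n fn] := @esum_inj_small R _ (fun y => `|f y| `^ p) e (eps `^ p) _ fp einj.
- by move=> y; rewrite powR_ge0.
- by rewrite powR_gt0.
have {}fn : `|f (e n)| <= eps.
  rewrite leNgt; apply/negP => lt; move: fn; apply/negP; rewrite -leNgt.
  by rewrite ge0_ler_powR ?nnegrE// ltW.
have tel m : `|f x| <= \sum_(i < m) `|f (e i.+1) - f (e i)| + `|f (e m)|.
  elim: m => [|m IHm].
    by rewrite big_ord0 add0r /e /along scale0r addr0.
  rewrite (le_trans IHm)// big_ord_recr/= -addrA lerD2l.
  by rewrite addrC -[in leLHS](subKr (f (e m.+1)) (f (e m))) ler_normB.
apply: (@le_trans _ _ ((\sum_(i < n) `|f (e i.+1) - f (e i)|)%:E + eps%:E)%E).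
  by rewrite -EFinD lee_fin (le_trans (tel n))// lerD2l.
rewrite leeD2r//; apply: esum_ge; exists [set e i | i in `I_n].
  split; first exact/finite_image/finite_II.
  move=> _ [i _ <-] j; rewrite inE => jk.
  by rewrite /e /along !mxE (negPf jk) andbF mulr0 addr0.
rewrite fsbig_image; last by move=> i j _ _ /einj.
rewrite -fsbig_ord sumEFin lee_fin; apply: ler_sum => i _.
rewrite le_eqVlt; apply/predU1P; left; congr (`|f _ - _|).
rewrite /e /along /lat_gen/= expr0 scale1r -addrA; congr (x + _).
by rewrite -[i.+1]addn1 PoszD scalerDl scale1r.
Qed.

(** * Sums of powers and second differences *)

Definition lpsum (R : realType) (N : nat) (p : R) (u : 'rV[int]_N -> R) :
    \bar R :=
  (\esum_(x in [set: 'rV[int]_N]) (`|u x| `^ p)%:E)%E.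

Section lpsum.
Variables (R : realType) (N : nat).
Implicit Types (u v : 'rV[int]_N -> R) (p c : R).

Lemma lpsum_ge0 p u : (0 <= lpsum p u)%E.
Proof. by apply: esum_ge0 => x _; rewrite lee_fin powR_ge0. Qed.

Lemma lpsum_fin_num p u : (lpsum p u < +oo)%E -> lpsum p u \is a fin_num.
Proof. by rewrite ge0_fin_numE// lpsum_ge0. Qed.

Lemma lnorm_lty p u : 0 < p -> (lnorm p u < +oo)%E <-> (lpsum p u < +oo)%E.
Proof.
move=> p0; split; last exact: poweR_lty.
by apply: lty_poweRy; rewrite invr_eq0 gt_eqF.
Qed.

Lemma lnorm_eq1 p u : 0 < p -> lnorm p u = 1%E <-> lpsum p u = 1%E.
Proof.
move=> p0; rewrite /lnorm -/(lpsum p u); split=> [u1|->]; last by rewrite poweR1r.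
have : poweR (poweR (lpsum p u) p^-1) p = 1%E by rewrite u1 poweR1r.
by rewrite -poweRrM mulVf ?gt_eqF// poweRe1// lpsum_ge0.
Qed.

Lemma esum_translate (f : 'rV[int]_N -> \bar R) (a : 'rV[int]_N) :
  (\esum_(x in [set: 'rV[int]_N]) f (x + a)%R
   = \esum_(x in [set: 'rV[int]_N]) f x)%E.
Proof.
apply/esym/reindex_esum; split=> // [x y _ _ /addIr//|y _].
by exists (y - a) => //; rewrite subrK.
Qed.

Lemma lpsum_translate p u a : lpsum p (fun x => u (a + x)) = lpsum p u.
Proof.
rewrite -[RHS](esum_translate _ a); apply: eq_esum => x _.
by rewrite addrC.
Qed.

Lemma lpsumZ p c u : lpsum p (fun x => c * u x) = ((`|c| `^ p)%:E * lpsum p u)%E.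
Proof.
rewrite -esumZ ?powR_ge0//.
by apply: eq_esum => x _; rewrite normrM powRM.
Qed.

(** Either |y| <= eta |x|, and the first term alone suffices, or
    |x| < |y| / eta, and the second does. With eta small, adding y to x costs
    little more than |x|^p plus a large multiple of |y|^p. *)
Lemma powR_normD_le p (eta x y : R) : 0 <= p -> 0 < eta ->
  `|x + y| `^ p <= (1 + eta) `^ p * `|x| `^ p + (1 + eta^-1) `^ p * `|y| `^ p.
Proof.
move=> p0 eta0; rewrite -!powRM ?addr_ge0 ?invr_ge0 ?(ltW eta0)//.
have xy := ler_normD x y.
have [yx|xy'] := lerP `|y| (eta * `|x|).
  apply: (@le_trans _ _ (((1 + eta) * `|x|) `^ p)).
    apply: ge0_ler_powR => //; rewrite ?nnegrE ?mulr_ge0 ?addr_ge0 ?(ltW eta0)//.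
    by rewrite mulrDl mul1r (le_trans xy)// lerD2l.
  by rewrite lerDl powR_ge0.
apply: (@le_trans _ _ (((1 + eta^-1) * `|y|) `^ p)).
  apply: ge0_ler_powR => //.
  - by rewrite nnegrE mulr_ge0// addr_ge0// invr_ge0 ltW.
  - rewrite mulrDl mul1r (le_trans xy)// addrC lerD2l.
    by rewrite ler_pdivlMl// ltW.
by rewrite lerDr powR_ge0.
Qed.

Lemma lpsumB_lty p u v : 0 <= p -> (lpsum p u < +oo)%E -> (lpsum p v < +oo)%E ->
  (lpsum p (fun x => (u x - v x)%R) < +oo)%E.
Proof.
move=> p0 ufin vfin.
apply: (@le_lt_trans _ _ (\esum_(x in [set: 'rV[int]_N])
    (((1 + 1)%R `^ p * `|u x| `^ p)%:E + ((1 + 1)%R `^ p * `|v x| `^ p)%:E))%E).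
  apply: le_esum => x _; rewrite -EFinD lee_fin.
  by have := @powR_normD_le p 1 (u x) (- v x) p0 ltr01; rewrite invr1 normrN.
rewrite esumD//.
under eq_esum do rewrite EFinM.
under [X in (_ + X)%E]eq_esum do rewrite EFinM.
rewrite !esumZ ?powR_ge0//.
by rewrite lte_add_pinfty// lte_mul_pinfty// ?lee_fin ?powR_ge0.
Qed.

Lemma lpsum_lat_diff p u s : 0 <= p -> (lpsum p u < +oo)%E ->
  (lpsum p (lat_diff s u) < +oo)%E.
Proof.
move=> p0 ufin; apply: lpsumB_lty => //.
suff -> : lpsum p (fun x => u (x + lat_gen s)) = lpsum p u by [].
rewrite -(lpsum_translate p u (lat_gen s)).
by congr lpsum; apply/funext => x; rewrite addrC.
Qed.

End lpsum.

(** Pointwise l^1 norm of the array of second differences; D21norm is its sum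
    over the lattice, so that one-series results apply to D21norm directly. *)
Definition hess1 (R : realType) (N : nat) (u : 'rV[int]_N -> R)
    (x : 'rV[int]_N) : R :=
  \sum_(i : 'I_N * bool) \sum_(j : 'I_N * bool) `|lat_diff j (lat_diff i u) x|.

Section D21norm.
Variables (R : realType) (N : nat).
Implicit Types (u v : 'rV[int]_N -> R).

Lemma D21norm_ge0 u : (0 <= D21norm u)%E.
Proof.
by do 2 apply: sume_ge0 => ? _; apply: esum_ge0 => x _; rewrite lee_fin.
Qed.

Lemma D21norm_ge u i j :
  (\esum_(x in [set: 'rV[int]_N]) `|lat_diff j (lat_diff i u) x|%:E
   <= D21norm u)%E.
Proof.
have ge0 k l :
    (0 <= \esum_(x in [set: 'rV[int]_N]) `|lat_diff l (lat_diff k u) x|%:E)%E.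
  by apply: esum_ge0 => x _; rewrite lee_fin.
rewrite /D21norm (bigD1 i)//= (bigD1 j)//= -addeA leeDl// adde_ge0//.
  by apply: sume_ge0.
by do 2 apply: sume_ge0 => ? _.
Qed.

Lemma D21norm_translate u a : D21norm (fun x => u (a + x)) = D21norm u.
Proof.
apply: eq_bigr => i _; apply: eq_bigr => j _.
rewrite -[RHS](esum_translate _ a); apply: eq_esum => x _.
by rewrite /lat_diff !addrA ![a + x]addrC.
Qed.

Lemma D21normZ c u : D21norm (fun x => c * u x) = (`|c|%:E * D21norm u)%E.
Proof.
have ge0 k l :
    (0 <= \esum_(x in [set: 'rV[int]_N]) `|lat_diff l (lat_diff k u) x|%:E)%E.
  by apply: esum_ge0 => x _; rewrite lee_fin.
rewrite ge0_sume_distrr => [|i _]; last exact: sume_ge0.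
apply: eq_bigr => i _; rewrite ge0_sume_distrr//; apply: eq_bigr => j _.
rewrite -esumZ//; apply: eq_esum => x _.
by rewrite /lat_diff -!mulrBr normrM.
Qed.

Lemma hess1_ge0 u x : 0 <= hess1 u x.
Proof. by do 2 apply: sumr_ge0 => ? _. Qed.

Lemma D21normE u :
  D21norm u = (\esum_(x in [set: 'rV[int]_N]) (hess1 u x)%:E)%E.
Proof.
rewrite /D21norm; under eq_bigr => i _.
  rewrite -esum_sum; last by move=> *; rewrite lee_fin.
  over.
rewrite -esum_sum; last by move=> x i _ _; apply: sume_ge0 => j _; rewrite lee_fin.
apply: eq_esum => x _; rewrite /hess1 -sumEFin; apply: eq_bigr => i _.
by rewrite sumEFin.
Qed.

Lemma hess1_sub_le u v x : hess1 (fun x => u x - v x) x <= hess1 u x + hess1 v x.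
Proof.
rewrite /hess1 -big_split; apply: ler_sum => i _.
rewrite -big_split; apply: ler_sum => j _ /=.
have -> : lat_diff j (lat_diff i (fun x => u x - v x)) x =
    lat_diff j (lat_diff i u) x - lat_diff j (lat_diff i v) x.
  by rewrite /lat_diff; lra.
exact: ler_normB.
Qed.

Lemma D21norm_sub_lty u v : (D21norm u < +oo)%E -> (D21norm v < +oo)%E ->
  (D21norm (fun x => (u x - v x)%R) < +oo)%E.
Proof.
rewrite !D21normE => ufin vfin; apply: le_lt_trans (lte_add_pinfty ufin vfin).
rewrite -esumD; try by move=> x _; rewrite lee_fin hess1_ge0.
by apply: le_esum => x _; rewrite -EFinD lee_fin hess1_sub_le.
Qed.

End D21norm.


(** * The Sobolev inequality *)

Lemma ordS_neq N (k : 'I_N) : (1 < N)%N -> ordS k != k.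
Proof.
move=> N1; apply/eqP => /(congr1 val)/=.
have := ltn_ord k; rewrite leq_eqVlt => /predU1P[kN|kN].
  by rewrite kN modnn => k0; move: N1; rewrite -kN -k0.
by rewrite modn_small// => /eqP; rewrite eqn_leq ltnn.
Qed.

(** A direction k is contained in exactly two of the N cyclic pairs
    {i, i + 1}, namely those with i = k and i + 1 = k. *)
Lemma card_ordS_avoid N (k : 'I_N) : (1 < N)%N ->
  #|[pred i : 'I_N | k \notin [set i; ordS i]%SET]| = (N - 2)%N.
Proof.
move=> N1.
have -> : #|[pred i : 'I_N | k \notin [set i; ordS i]%SET]| =
    #|~: [set k; ord_pred k]%SET|.
  apply: eq_card => i; rewrite !inE; congr (~~ (_ || _)); first exact: eq_sym.
  by rewrite -(inj_eq (can_inj (@ord_predK _)) k) ordSK eq_sym.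
rewrite cardsCs finset.setCK card_ord cards2.
by rewrite -(inj_eq (can_inj (@ordSK _)) k) ord_predK ordS_neq.
Qed.

(** Telescoping in the direction k bounds u by a line sum of d_k u; telescoping
    in the direction l, for the function d_k u, which is again in l^p, turns
    this into a plane sum. *)
Lemma normr_le_esum_slice2 (R : realType) N (k l : 'I_N) (u : 'rV[int]_N -> R)
    (p : R) (x : 'rV[int]_N) : 0 < p -> k != l -> (lpsum p u < +oo)%E ->
  (`|u x|%:E <= \esum_(y in slice [set k; l]%SET x)
     `|lat_diff (l, false) (lat_diff (k, false) u) y|%:E)%E.
Proof.
move=> p0 kl ufin.
rewrite esum_slice_setU1 ?inE//.
apply: le_trans (normr_le_esum_diff k x p0 ufin) _.
rewrite -[X in slice X](finset.setU0 [set k]%SET) esum_slice_setU1 ?inE//.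
apply: le_esum => t _; rewrite slice0 esum_set1//.
by apply: (normr_le_esum_diff _ _ p0); apply: lpsum_lat_diff => //; exact: ltW.
Qed.

Lemma crit_exp_gt0 (R : realType) N : (3 <= N)%N -> 0 < crit_exp R N.
Proof.
move=> N3; rewrite /crit_exp divr_gt0 ?ltr0n ?(leq_trans _ N3)//.
by rewrite subr_gt0 ltr_nat.
Qed.

Lemma crit_exp_gt1 (R : realType) N : (3 <= N)%N -> 1 < crit_exp R N.
Proof.
move=> N3; rewrite /crit_exp ltr_pdivlMr ?mul1r ?subr_gt0 ?ltr_nat//.
by rewrite ltrBlDr ltrDl.
Qed.

(** The product over i of the plane bounds for the directions i and i + 1, each
    raised to the power 1 / (N - 2), dominates |u|^(N / (N - 2)); by
    [esum_finner] with S = all directions its sum over the lattice is at most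
    the product of the N total sums of second differences to the same power. *)
Lemma sobolev (R : realType) N (u : 'rV[int]_N -> R) : (3 <= N)%N -> D21 u ->
  (lpsum (crit_exp R N) u <= poweR (D21norm u) (crit_exp R N))%E.
Proof.
move=> N3 [unorm Dfin]; have p0 := @crit_exp_gt0 R N N3.
have N1 : (1 < N)%N by exact: ltn_trans N3.
have ufin : (lpsum (crit_exp R N) u < +oo)%E by apply/lnorm_lty.
have powE (a : R) : a `^ crit_exp R N = \prod_(i : 'I_N) a `^ (N - 2)%:R^-1.
  rewrite prodr_const card_ord -powR_mulrn ?powR_ge0// -powRrM.
  by rewrite /crit_exp natrB// mulrC.
pose g (i : 'I_N) y := `|lat_diff (ordS i, false) (lat_diff (i, false) u) y|.
have g0 i y : 0 <= g i y by exact: normr_ge0.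
have gfin i : (\esum_(y in [set: 'rV[int]_N]) (g i y)%:E < +oo)%E.
  apply: le_lt_trans Dfin.
  exact: (D21norm_ge u (i, false) (ordS i, false)).
have sliceE i S y := fineK (fin_num_esum (slice S y) (g0 i) (gfin i)).
have := @esum_finner R N _ (fun i => [set i; ordS i]%SET) (N - 2)%N g _ _ g0 gfin
  [set: 'I_N]%SET 0.
rewrite subn_gt0 N3 => /(_ isT (fun k => card_ordS_avoid k N1)).
rewrite sliceT => le; apply: le_trans (le_trans _ le) _.
- apply: le_esum => y _; rewrite lee_fin powE.
  apply: ler_prod => i _; rewrite powR_ge0/= ge0_ler_powR ?invr_ge0//.
  + by rewrite nnegrE fine_ge0// esum_ge0// => z _; rewrite lee_fin.
  + rewrite -lee_fin sliceE; apply: normr_le_esum_slice2 p0 _ ufin.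
    by rewrite eq_sym ordS_neq.
- have DE : D21norm u = (fine (D21norm u))%:E.
    by rewrite fineK// ge0_fin_numE// D21norm_ge0.
  rewrite DE poweR_EFin lee_fin powE.
  apply: ler_prod => i _; rewrite powR_ge0/= ge0_ler_powR ?invr_ge0//.
  + by rewrite nnegrE fine_ge0// esum_ge0// => z _; rewrite lee_fin.
  + by rewrite nnegrE fine_ge0// D21norm_ge0.
  + rewrite -lee_fin sliceE -DE.
    apply: le_trans (D21norm_ge u (i, false) (ordS i, false)).
    exact: le_esum_sub.
Qed.

(** * Pointwise convergence along a filter *)

Section near_esum.
Variables (R : realType) (T : choiceType) (F : set_system nat).
Implicit Types (f g : nat -> T -> R) (a b l : T -> R).

Lemma cvg_fsbig (FF : Filter F) f l (A : set T) : finite_set A ->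
  (forall x, f n x @[n --> F] --> l x) ->
  \sum_(x \in A) f n x @[n --> F] --> \sum_(x \in A) l x.
Proof.
move=> finA fl; rewrite fsbig_finite//.
under eq_fun do rewrite fsbig_finite//.
by apply: cvg_big => [|x _]; [exact: add_continuous|exact: fl].
Qed.

(** Fatou's lemma along a filter: a finite partial sum of the limit is the limit
    of partial sums bounded by C. *)
Lemma esum_le_cvg (FF : ProperFilter F) f l (C : R) :
  (forall n x, 0 <= f n x) -> (forall x, f n x @[n --> F] --> l x) ->
  (\forall n \near F, (\esum_(x in [set: T]) (f n x)%:E <= C%:E)%E) ->
  (\esum_(x in [set: T]) (l x)%:E <= C%:E)%E.
Proof.
move=> f0 fl fC; apply: ge_ereal_sup => _ [A [finA _] <-].
rewrite fsumEFin// lee_fin; apply: (cvgr_to_le (cvg_fsbig _ finA fl)).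
apply: filterS fC => n; rewrite -lee_fin -fsumEFin//; apply: le_trans.
by apply: esum_ge; exists A.
Qed.

(** Dominated convergence in one-sided form. Outside a finite set A carrying
    almost all of b, f exceeds g by at most a small total; on A, f and g have
    the same pointwise limit, so their finite sums are eventually close. *)
Lemma near_esum_le (FF : Filter F) f g b l (eps : R) :
  (forall n x, 0 <= f n x) -> (forall n x, 0 <= g n x) -> (forall x, 0 <= b x) ->
  (forall n x, f n x <= g n x + b x) ->
  (\esum_(x in [set: T]) (b x)%:E < +oo)%E ->
  (forall x, f n x @[n --> F] --> l x) -> (forall x, g n x @[n --> F] --> l x) ->
  0 < eps ->
  \forall n \near F, (\esum_(x in [set: T]) (f n x)%:E
    <= \esum_(x in [set: T]) (g n x)%:E + eps%:E)%E.
Proof.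
move=> f0 g0 b0 fgb bfin fl gl eps0.
have e20 : 0 < eps / 2 by rewrite divr_gt0.
have bfn := fin_num_esum setT b0 bfin.
have [_ [A [finA _] <-] Ab] := ub_ereal_sup_adherent e20 bfn.
have esumE (a : T -> R) : (forall x, 0 <= a x) ->
    (\esum_(x in [set: T]) (a x)%:E = (\sum_(x \in A) a x)%:E +
      \esum_(x in ~` A) (a x)%:E)%E.
  move=> a0; rewrite (esumID A)//; last by move=> x _; rewrite lee_fin.
  rewrite !setTI esum_fset// => [|x _]; last by rewrite lee_fin.
  by congr (_ + _)%E; exact: fsumEFin.
have tail : (\esum_(x in ~` A) (b x)%:E <= (eps / 2)%:E)%E.
  have {Ab} : (\esum_(x in [set: T]) (b x)%:E - (eps / 2)%:E <
      (\sum_(x \in A) b x)%:E)%E by rewrite -fsumEFin.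
  rewrite esumE//.
  rewrite lteBlDr// lteD2lE//; exact: ltW.
have fg0 :=
  @cvgB _ _ _ F FF _ _ _ _ (cvg_fsbig FF finA fl) (cvg_fsbig FF finA gl).
have := @cvgr_dist_lt _ _ _ F FF _ _ fg0 _ e20; apply: filterS => n.
rewrite subrr sub0r normrN => lt.
rewrite !esumE//.
have -> : eps = eps / 2 + eps / 2 by lra.
apply: (@le_trans _ _ ((\sum_(x \in A) g n x + eps / 2)%:E +
   (\esum_(x in ~` A) (g n x)%:E + \esum_(x in ~` A) (b x)%:E))%E).
  apply: leeD.
    by rewrite lee_fin -lerBlDl (le_trans (ler_norm _))// ltW.
  rewrite -esumD; try by move=> x _; rewrite lee_fin.
  by apply: le_esum => x _; rewrite -EFinD lee_fin.
rewrite !EFinD -!addeA leeD2l// addeCA leeD2l// leeD2l//.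
Qed.

End near_esum.

(** Away from 0 this is differentiability of the power; at 0 it is checked by
    hand. *)
Lemma cvg_norm_powR (R : realType) (F : set_system nat) (FF : Filter F)
    (f : nat -> R) (a p : R) : 0 < p -> f n @[n --> F] --> a ->
  `|f n| `^ p @[n --> F] --> `|a| `^ p.
Proof.
move=> p0 fa; have [a0|a0] := eqVneq a 0.
  rewrite a0 normr0 powR0 ?gt_eqF//; apply/cvgrPdist_lt => eps eps0.
  have e0 : 0 < eps `^ p^-1 by rewrite powR_gt0.
  move: fa; rewrite a0 => /cvgrPdist_lt/(_ _ e0); apply: filterS => n.
  rewrite !sub0r !normrN => lt; rewrite (ger0_norm (powR_ge0 _ _)).
  have := gt0_ltr_powR p0 _ _ lt.
  rewrite -powRrM mulVf ?gt_eqF// powRr1 ?(ltW eps0)// => ->//.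
  by rewrite nnegrE ltW.
apply: (@cvg_comp _ _ _ (fun n => `|f n|) (fun x => x `^ p) _ (nbhs `|a|)).
  exact: cvg_norm.
rewrite -/(continuous_at `|a| (fun x => x `^ p)); apply: differentiable_continuous.
apply/derivable1_diffP.
by apply: derivable_powR; rewrite in_itv/= andbT normr_gt0.
Qed.

(** Compactness of [-M, M] provides a cluster point, and along an ultrafilter a
    cluster point is a limit. *)
Lemma filter_cvg_bounded (R : realType) (F : set_system nat) (UF : UltraFilter F)
    (f : nat -> R) (M : R) : (forall n, `|f n| <= M) ->
  exists l : R, f n @[n --> F] --> l.
Proof.
move=> fM.
have [|l [_ lcl]] := @segment_compact R (- M) M (fmap f F) _.
  apply: (@filterS _ F _ setT); last exact: filterT.
  by move=> n _ /=; rewrite in_itv/= -ler_norml.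
exists l => B Bl; have [//|FnB] := in_ultra_setVsetC (f @^-1` B) UF.
by have [y []] := lcl (~` B) B FnB Bl.
Qed.

Section convergence.
Variables (R : realType) (N : nat).
Implicit Types (u v : 'rV[int]_N -> R) (w : nat -> 'rV[int]_N -> R).

Lemma cvg_hess1 (F : set_system nat) (FF : Filter F) w v x :
  (forall y, w n y @[n --> F] --> v y) -> hess1 (w n) x @[n --> F] --> hess1 v x.
Proof.
move=> wv; apply: cvg_big => [|i _]; first exact: add_continuous.
apply: cvg_big => [|j _]; first exact: add_continuous.
apply: cvg_norm; rewrite /lat_diff.
apply: cvgB; apply: cvgB; exact: wv.
Qed.

Lemma D21norm_le_cvg (F : set_system nat) (FF : ProperFilter F) w v (C : R) :
  (forall y, w n y @[n --> F] --> v y) ->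
  (\forall n \near F, (D21norm (w n) <= C%:E)%E) -> (D21norm v <= C%:E)%E.
Proof.
move=> wv wC; rewrite D21normE.
apply: (esum_le_cvg FF (f := fun n => hess1 (w n))).
- by move=> n x; exact: hess1_ge0.
- by move=> x; exact: cvg_hess1.
- by apply: filterS wC => n; rewrite D21normE.
Qed.

Lemma lpsum_le_cvg (F : set_system nat) (FF : ProperFilter F) w v (p C : R) :
  0 < p -> (forall y, w n y @[n --> F] --> v y) ->
  (\forall n \near F, (lpsum p (w n) <= C%:E)%E) -> (lpsum p v <= C%:E)%E.
Proof.
move=> p0 wv; apply: (esum_le_cvg FF) => [n x|x]; first exact: powR_ge0.
exact: cvg_norm_powR.
Qed.

(** [near_esum_le] for the integrands of D (w - v) + D v and of D w: both tend
    to that of D v, and they differ by at most twice that of D v. *)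
Lemma near_D21norm_split (F : set_system nat) (FF : Filter F) w v (eps : R) :
  (forall y, w n y @[n --> F] --> v y) -> (D21norm v < +oo)%E -> 0 < eps ->
  \forall n \near F,
    (D21norm (fun x => (w n x - v x)%R) + D21norm v <= D21norm (w n) + eps%:E)%E.
Proof.
move=> wv vfin eps0.
have h0 (u : 'rV[int]_N -> R) x : 0 <= hess1 u x by exact: hess1_ge0.
have hfin : (\esum_(x in [set: 'rV[int]_N]) (2 * hess1 v x)%:E < +oo)%E.
  under eq_esum do rewrite EFinM.
  rewrite esumZ => [||x]; rewrite ?lee_fin// -(D21normE v).
  by rewrite lte_mul_pinfty// lee_fin.
have wv0 x : hess1 (fun x => w n x - v x) x @[n --> F] --> (0 : R).
  have -> : 0 = hess1 (fun x => v x - v x) x.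
    rewrite /hess1 big1// => i _; rewrite big1// => j _.
    by rewrite /lat_diff !subrr normr0.
  by apply: cvg_hess1 => y; apply: cvgB; [exact: wv|exact: cvg_cst].
pose f n x := hess1 (fun x => w n x - v x) x + hess1 v x.
pose g n x := hess1 (w n) x.
pose b x := 2 * hess1 v x.
have f0 n x : 0 <= f n x by rewrite addr_ge0.
have b0 x : 0 <= b x by rewrite mulr_ge0.
have fgb n x : f n x <= g n x + b x.
  by rewrite /f /g /b; have := hess1_sub_le (w n) v x; lra.
have fl x : f n x @[n --> F] --> hess1 v x.
  rewrite -[hess1 v x in X in _ --> X]add0r.
  by apply: cvgD; [exact: wv0|exact: cvg_cst].
have gl x : g n x @[n --> F] --> hess1 v x by exact: cvg_hess1.
have := near_esum_le FF f0 (fun n => h0 (w n)) b0 fgb hfin fl gl eps0.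
apply: filterS => n; rewrite !D21normE -esumD; try by move=> x _; rewrite lee_fin.
by under eq_esum do rewrite EFinD.
Qed.

(** With (1 + eta)^p = c, [powR_normD_le] gives
    |w|^p <= c |w - v|^p + C |v|^p, whose last term is summable, and both |w|^p
    and |v|^p + c |w - v|^p tend pointwise to |v|^p. So [near_esum_le]
    applies. *)
Lemma near_lpsum_split (F : set_system nat) (FF : Filter F) w v (p c eps : R) :
  0 < p -> (forall y, w n y @[n --> F] --> v y) -> (lpsum p v < +oo)%E ->
  1 < c -> 0 < eps ->
  \forall n \near F, (lpsum p (w n) <=
    lpsum p v + c%:E * lpsum p (fun x => (w n x - v x)%R) + eps%:E)%E.
Proof.
move=> p0 wv vfin c1 eps0.
have c0 : 0 < c by exact: lt_trans c1.
pose eta := c `^ p^-1 - 1.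
have eta0 : 0 < eta.
  have pV0 : 0 < p^-1 by rewrite invr_gt0.
  have := @gt0_ltr_powR R _ pV0 1 c; rewrite powR1 subr_gt0; apply; rewrite ?nnegrE//.
  exact: ltW.
have etaE : (1 + eta) `^ p = c.
  by rewrite addrC subrK -powRrM mulVf ?gt_eqF// powRr1 ?ltW.
pose b x := (1 + eta^-1) `^ p * `|v x| `^ p.
have bfin : (\esum_(x in [set: 'rV[int]_N]) (b x)%:E < +oo)%E.
  under eq_esum do rewrite EFinM.
  by rewrite esumZ ?powR_ge0// lte_mul_pinfty// lee_fin powR_ge0.
pose f n x := `|w n x| `^ p.
pose g n x := `|v x| `^ p + c * `|w n x - v x| `^ p.
have f0 n x : 0 <= f n x by exact: powR_ge0.
have g0 n x : 0 <= g n x by rewrite addr_ge0 ?mulr_ge0 ?powR_ge0// ltW.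
have b0 x : 0 <= b x by rewrite mulr_ge0 ?powR_ge0.
have fgb n x : f n x <= g n x + b x.
  have := powR_normD_le (w n x - v x) (v x) (ltW p0) eta0.
  by rewrite subrK etaE -/(b x) => /le_trans; apply; rewrite lerD2r lerDr powR_ge0.
have fl x : f n x @[n --> F] --> `|v x| `^ p by exact: cvg_norm_powR.
have gl x : g n x @[n --> F] --> `|v x| `^ p.
  have wv0 : w n x - v x @[n --> F] --> (0 : R).
    by rewrite -(subrr (v x)); apply: cvgB; [exact: wv|exact: cvg_cst].
  rewrite -[`|v x| `^ p in X in _ --> X]addr0; apply: cvgD; first exact: cvg_cst.
  rewrite -(mulr0 c); apply: cvgM; first exact: cvg_cst.
  have := cvg_norm_powR FF p0 wv0.
  by rewrite normr0 powR0 ?gt_eqF.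
have := near_esum_le FF f0 g0 b0 fgb bfin fl gl eps0.
apply: filterS => n; rewrite /lpsum -esumZ ?(ltW c0)//.
rewrite -esumD; try by move=> x _; rewrite ?mule_ge0 ?lee_fin ?powR_ge0 ?(ltW c0).
by under [in leRHS]eq_esum do rewrite EFinD EFinM.
Qed.

End convergence.

(** * The variational problem *)

Lemma lpsum_interpolate (R : realType) N (p q M : R) (u : 'rV[int]_N -> R) :
  0 < p -> p <= q -> 0 <= M -> (forall x, `|u x| <= M) ->
  (lpsum q u <= (M `^ (q - p))%:E * lpsum p u)%E.
Proof.
move=> p0 pq M0 uM; rewrite /lpsum -esumZ ?powR_ge0//.
apply: le_esum => x _; rewrite -EFinM lee_fin.
have q0 : 0 < q by exact: lt_le_trans pq.
have -> : `|u x| `^ q = `|u x| `^ (q - p) * `|u x| `^ p.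
  by rewrite -powRD subrK// gt_eqF.
by rewrite ler_wpM2r ?powR_ge0// ge0_ler_powR ?subr_ge0 ?nnegrE.
Qed.

Lemma normr_le_lpsum (R : realType) N (p : R) (u : 'rV[int]_N -> R) x :
  0 < p -> (lpsum p u < +oo)%E -> `|u x| <= fine (lpsum p u) `^ p^-1.
Proof.
move=> p0 ufin.
have le : `|u x| `^ p <= fine (lpsum p u).
  rewrite -lee_fin fineK ?lpsum_fin_num//.
  by apply: (@esum_sup1 R _ setT (fun x => (`|u x| `^ p)%:E)).
have -> : `|u x| = (`|u x| `^ p) `^ p^-1 by rewrite -powRrM mulfV ?gt_eqF// powRr1.
rewrite ge0_ler_powR ?invr_ge0 ?(ltW p0) ?nnegrE ?powR_ge0//.
exact: le_trans le.
Qed.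

Lemma normr_le1 (R : realType) N (p : R) (u : 'rV[int]_N -> R) x :
  0 < p -> (lpsum p u <= 1)%E -> `|u x| <= 1.
Proof.
move=> p0 u1; have ufin : (lpsum p u < +oo)%E by rewrite (le_lt_trans u1)// ltry.
apply: le_trans (normr_le_lpsum x p0 ufin) _.
have -> : 1 = 1 `^ p^-1 :> R by rewrite powR1.
rewrite ge0_ler_powR ?invr_ge0 ?(ltW p0) ?nnegrE ?fine_ge0 ?lpsum_ge0//.
by rewrite -lee_fin fineK// lpsum_fin_num.
Qed.

Lemma lpsum_embed_lty (R : realType) N (p q : R) (u : 'rV[int]_N -> R) :
  0 < p -> p <= q -> (lpsum p u < +oo)%E -> (lpsum q u < +oo)%E.
Proof.
move=> p0 pq ufin.
apply: le_lt_trans (lpsum_interpolate p0 pq (powR_ge0 _ _)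
  (fun x => normr_le_lpsum x p0 ufin)) _.
by rewrite lte_mul_pinfty// lee_fin powR_ge0.
Qed.

Lemma D21norm_ge1 (R : realType) N (q : R) (u : 'rV[int]_N -> R) :
  (3 <= N)%N -> crit_exp R N < q -> D21 u -> lpsum q u = 1%E ->
  (1 <= D21norm u)%E.
Proof.
move=> N3 hq uD u1; have p0 := @crit_exp_gt0 R N N3.
have q0 : 0 < q by exact: lt_trans hq.
have le : (1 <= poweR (D21norm u) (crit_exp R N))%E.
  rewrite -{1}u1; apply: le_trans (sobolev N3 uD).
  apply: le_trans (lpsum_interpolate (M := 1) p0 (ltW hq) _ _) _ => //.
    by move=> x; apply: (normr_le1 x q0); rewrite u1.
  by rewrite powR1 mul1e.
rewrite leNgt; apply/negP => D1; move: le; apply/negP; rewrite -ltNge.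
case: (D21norm u) (D21norm_ge0 u) D1 => [d|//|//]; rewrite lee_fin lte_fin => d0 d1.
rewrite poweR_EFin lte_fin.
by have := @gt0_ltr_powR R _ p0 d 1; rewrite powR1; apply; rewrite ?nnegrE.
Qed.

Lemma Ktilde_ge1 (R : realType) N (q : R) :
  (3 <= N)%N -> crit_exp R N < q -> (1 <= Ktilde N q)%E.
Proof.
move=> N3 hq; apply: le_ereal_inf_tmp => _ [u [uD u1] <-].
apply: (D21norm_ge1 N3 hq uD); apply/lnorm_eq1 => //.
exact: lt_trans (crit_exp_gt0 R N3) hq.
Qed.

Lemma D21_translate (R : realType) N (u : 'rV[int]_N -> R) a :
  (3 <= N)%N -> D21 u -> D21 (fun x => u (a + x)).
Proof.
move=> N3 [/(lnorm_lty _ (crit_exp_gt0 R N3)) up uD]; split.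
  by apply/(lnorm_lty _ (crit_exp_gt0 R N3)); rewrite lpsum_translate.
by rewrite D21norm_translate.
Qed.

Lemma D21B (R : realType) N (u v : 'rV[int]_N -> R) :
  (3 <= N)%N -> D21 u -> D21 v -> D21 (fun x => u x - v x).
Proof.
move=> N3; have p0 := crit_exp_gt0 R N3.
move=> [/(lnorm_lty _ p0) up uD] [/(lnorm_lty _ p0) vp vD]; split.
  by apply/(lnorm_lty _ p0); apply: lpsumB_lty => //; exact: ltW.
exact: D21norm_sub_lty.
Qed.

(** The variational problem is homogeneous: rescale u to unit l^q norm. *)
Lemma Ktilde_le (R : realType) N (q k b : R) (u : 'rV[int]_N -> R) :
  (3 <= N)%N -> crit_exp R N < q -> Ktilde N q = k%:E ->
  D21 u -> lpsum q u = b%:E -> ((k * b `^ q^-1)%:E <= D21norm u)%E.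
Proof.
move=> N3 hq kE [up uD] ub; have p0 := crit_exp_gt0 R N3.
have q0 : 0 < q by exact: lt_trans hq.
have : (0 <= b%:E)%E by rewrite -ub lpsum_ge0.
rewrite lee_fin le_eqVlt => /predU1P[<-|b0].
  by rewrite powR0 ?invr_eq0 ?gt_eqF// mulr0 D21norm_ge0.
set s := b `^ q^-1; have s0 : 0 < s by rewrite powR_gt0.
have sV0 : 0 <= s^-1 by rewrite invr_ge0 ltW.
have : (Ktilde N q <= D21norm (fun x => (s^-1 * u x)%R))%E.
  apply: ereal_inf_lbound; exists (fun x => s^-1 * u x) => //; split.
    split; last by rewrite D21normZ lte_mul_pinfty// lee_fin.
    apply/(lnorm_lty _ p0); rewrite lpsumZ lte_mul_pinfty ?lee_fin ?powR_ge0//.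
    exact/(lnorm_lty _ p0).
  apply/(lnorm_eq1 _ q0); rewrite lpsumZ ub -EFinM ger0_norm// /s -powRN.
  by rewrite -powRrM mulNr mulVf ?gt_eqF// powR_inv1 ?ltW// mulVf ?gt_eqF.
rewrite kE D21normZ ger0_norm// mulrC EFinM => le.
apply: le_trans (lee_wpmul2l _ le) _; first by rewrite lee_fin ltW.
by rewrite muleA -EFinM divff ?gt_eqF// mul1e.
Qed.

(** If |u| <= c everywhere, interpolation bounds the sum of |u|^q by
    c^(q - p) * B, which is below 1 for the c chosen here. *)
Lemma nonvanishing (R : realType) N (p q B : R) : 0 < p -> p < q -> 0 <= B ->
  exists2 c : R, 0 < c & forall u : 'rV[int]_N -> R,
    (lpsum p u <= B%:E)%E -> lpsum q u = 1%E -> exists x, c <= `|u x|.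
Proof.
move=> p0 pq B0; have qp0 : 0 < q - p by rewrite subr_gt0.
have B10 : 0 < B + 1 by rewrite ltr_pwDr.
(* chosen so that c^(q - p) * B = B / (B + 1) < 1 *)
pose c := (B + 1)^-1 `^ (q - p)^-1.
have c0 : 0 < c by rewrite powR_gt0// invr_gt0.
exists c => // u uB u1; apply: contrapT => /forallNP lt.
have {}lt x : `|u x| <= c by rewrite ltW// ltNge; apply/negP/lt.
have := lpsum_interpolate p0 (ltW pq) (ltW c0) lt.
rewrite u1 /c -powRrM mulVf ?gt_eqF// powRr1 ?invr_ge0 ?(ltW B10)//.
move=> le; have : (1 <= ((B + 1)^-1 * B)%:E)%E.
  by apply: le_trans le _; rewrite EFinM lee_wpmul2l// lee_fin invr_ge0 ltW.
rewrite lee_fin mulrC ler_pdivlMr// mul1r; lra.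
Qed.

(** Strict subadditivity of the energy as a function of the mass. Here a is the
    mass kept by the limit, with energy d, and b is the mass that escapes, with
    energy e. Since b^(1/q) >= min b 1, the escaping part costs at least
    k * (1 - a) up to O(eps), so a^(1/q) <= a + O(eps). For q > 1 this excludes
    0 < a < 1. *)
Lemma no_dichotomy (R : realType) (k q a d : R) : 1 <= k -> 1 < q ->
  0 < a -> a <= 1 -> k * a `^ q^-1 <= d ->
  (forall eps : R, 0 < eps -> exists b e : R,
     [/\ 0 <= b, k * b `^ q^-1 <= e, 1 <= a + (1 + eps) * b + eps
       & e + d <= k + 2 * eps]) ->
  a = 1.
Proof.
move=> k1 q1 a0 a1 kd H.
have q0 : 0 < q by exact: lt_trans q1.
apply/eqP; rewrite eq_le a1 leNgt; apply/negP => alt.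
have key : a `^ q^-1 <= a.
  apply/ler_addgt0Pr => eps eps0.
  have e40 : 0 < eps / 4 by rewrite divr_gt0.
  have [b [e [b0 be ab ed]]] := H _ e40; set t := eps / 4 in e40 ab ed.
  have bm : 1 - a - 2 * t <= b `^ q^-1.
    have [b1|b1] := lerP 1 b.
      have : 1 <= b `^ q^-1.
        have -> : 1 = 1 `^ q^-1 :> R by rewrite powR1.
        by rewrite ge0_ler_powR ?invr_ge0 ?(ltW q0) ?nnegrE.
      lra.
    have bq : b <= b `^ q^-1.
      move: b0; rewrite le_eqVlt => /predU1P[<-|b0]; first exact: powR_ge0.
      by rewrite ger1_powR ?b0 ?(ltW b1)// invf_le1 ?ltW.
    nra.
  set A := a `^ q^-1 in kd *; set Bq := b `^ q^-1 in be bm *.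
  have -> : eps = 4 * t by rewrite /t; lra.
  have : k * (A + Bq) <= k + 2 * t by lra.
  have : k * (A + (1 - a - 2 * t)) <= k * (A + Bq) by rewrite ler_wpM2l; lra.
  clearbody A Bq t; nra.
have : a < a `^ q^-1; last by rewrite ltNge key.
have qV0 : 0 < q^-1 by rewrite invr_gt0.
have qV1 : q^-1 < 1 by rewrite invf_lt1.
have e0 : 0 < 1 - q^-1 by rewrite subr_gt0.
have lt1 : a `^ (1 - q^-1) < 1.
  have := @gt0_ltr_powR R _ e0 a 1; rewrite powR1; apply => //; rewrite nnegrE//.
  exact: ltW.
rewrite -[X in X < _](powRr1 (ltW a0)) -{1}(subrK q^-1 1) powRD; last first.
  by rewrite subrK oner_eq0.
by rewrite gtr_pMl// powR_gt0.
Qed.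

(** * Compactness of minimizing sequences *)

(** Sets in F meet every final segment of nat, so k (m + 1) can be chosen beyond
    k m with d (k (m + 1)) <= 1 / (m + 2). *)
Lemma extract_subseq (R : realType) (F : set_system nat) (FF : ProperFilter F)
    (d : nat -> \bar R) : \oo `<=` F -> (forall n, (0 <= d n)%E) ->
  (forall eps : R, 0 < eps -> \forall n \near F, (d n <= eps%:E)%E) ->
  exists k : nat -> nat, {homo k : i j / (i < j)%N} /\
    d (k n) @[n --> \oo] --> 0%E.
Proof.
move=> ooF d0 dF.
have pick (mn : nat * nat) :
    exists n, (mn.2 <= n)%N /\ (d n <= (mn.1.+1%:R^-1)%:E)%E.
  have e0 : 0 < mn.1.+1%:R^-1 :> R by rewrite invr_gt0.
  have big : F [set n | (mn.2 <= n)%N] by apply: ooF; exists mn.2.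
  by have [n [? ?]] := filter_ex (filterI big (dF _ e0)); exists n.
have [g gP] := choice pick.
pose k := fix k m := if m is m'.+1 then g (m, (k m').+1) else g (0%N, 0%N).
have kS m : (k m < k m.+1)%N by have [] := gP (m.+1, (k m).+1).
have kd m : (d (k m) <= (m.+1%:R^-1)%:E)%E.
  by case: m => [|m]; [have [] := gP (0%N, 0%N)|have [] := gP (m.+1, (k m).+1)].
exists k; split; first by apply: homo_ltn kS; exact: ltn_trans.
apply: (@squeeze_cvge _ _ _ _ (cst 0%E) _ (fun n => (n.+1%:R^-1)%:E)).
- by apply: nearW => n; rewrite d0 kd.
- exact: cvg_cst.
- by apply: cvg_EFin; [exact: nearW|exact: cvg_harmonic].
Qed.

Theorem theorem20 (R : realType) (N : nat) (q : R)
    (hN : (3 <= N)%N) (hq : crit_exp R N < q)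
    (u : nat -> 'rV[int]_N -> R)
    (uD : forall n, D21 (u n))
    (u1 : forall n, lnorm q (u n) = 1%E)
    (uK : D21norm (u n) @[n --> \oo] --> Ktilde N q) :
  exists (x_ : nat -> 'rV[int]_N) (v : 'rV[int]_N -> R),
    [/\ D21 v,
        exists k : nat -> nat, {homo k : i j / (i < j)%N} /\
          D21norm (fun x => u (k n) (x_ (k n) + x) - v x) @[n --> \oo] --> 0%E,
        lnorm q v = 1%E
      & D21norm v = Ktilde N q].
Proof.
set p := crit_exp R N in hq *.
have p0 : 0 < p := crit_exp_gt0 R hN.
have p1 : 1 < p := crit_exp_gt1 R hN.
have q0 : 0 < q by exact: lt_trans hq.
have {}u1 n : lpsum q (u n) = 1%E by apply/(lnorm_eq1 _ q0).
have K1 : (1 <= Ktilde N q)%E := Ktilde_ge1 hN hq.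
have [k kE] : exists k : R, Ktilde N q = k%:E.
  exists (fine (Ktilde N q)); rewrite fineK// ge0_fin_numE ?(le_trans _ K1)//.
  apply: le_lt_trans (proj2 (uD 0%N)); apply: ereal_inf_lbound.
  by exists (u 0%N) => //; split=> //; exact/(lnorm_eq1 _ q0).
rewrite kE lee_fin in K1; rewrite kE in uK.
have uKoo (eps : R) : 0 < eps ->
    \forall n \near \oo, (D21norm (u n) <= (k + eps)%:E)%E.
  move=> eps0; have ke : k < k + eps by rewrite ltrDl.
  have fK : fine (D21norm (u n)) @[n --> \oo] --> k by exact: fine_cvg uK.
  have : \forall n \near \oo, fine (D21norm (u n)) <= k + eps.
    exact: (cvgr_le k fK).
  apply: filterS => n /=.
  rewrite -lee_fin fineK//; have [_ Dfin] := uD n.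
  by rewrite ge0_fin_numE// D21norm_ge0.
have k10 : 0 <= k + 1 by rewrite addr_ge0// (le_trans _ K1).
pose B := (k + 1) `^ p.
have B0 : 0 <= B by exact: powR_ge0.
have uB n : (D21norm (u n) <= (k + 1)%:E)%E -> (lpsum p (u n) <= B%:E)%E.
  move=> le; apply: le_trans (sobolev hN (uD n)) _.
  rewrite /B -poweR_EFin; apply: gt0_ler_poweR => //; first exact: ltW.
  - by rewrite in_itv/= leey andbT D21norm_ge0.
  - by rewrite in_itv/= leey andbT lee_fin.
(* D (u n) <= k + 1 holds only eventually; the default translation is 0. *)
have [c c0 cP] := @nonvanishing R N p q B p0 hq B0.
have /choice[x_ x_P] : forall n, exists x,
    (D21norm (u n) <= (k + 1)%:E)%E -> c <= `|u n x|.
  move=> n; have [le|nle] := pselect (D21norm (u n) <= (k + 1)%:E)%E.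
    by have [x cx] := cP _ (uB n le) (u1 n); exists x.
  by exists 0.
pose w n (x : 'rV[int]_N) := u n (x_ n + x).
have wD n : D21 (w n) by exact: D21_translate.
have wDE n : D21norm (w n) = D21norm (u n) by exact: D21norm_translate.
have wq n : lpsum q (w n) = 1%E by rewrite lpsum_translate.
have w1 n x : `|w n x| <= 1 by apply: (normr_le1 x q0); rewrite wq.
(* U refines the Frechet filter, so it sees every eventual property, and the
   bounded sequences w n x converge along it. *)
have [U [UU ooU]] := @ultraFilterLemma nat \oo _.
have UF : ProperFilter U by exact: ultra_proper.
have /choice[v wv] : forall x, exists l : R, w n x @[n --> U] --> l.
  by move=> x; exact: (filter_cvg_bounded UU (w1^~ x)).
have wK (eps : R) : 0 < eps ->
    \forall n \near U, (D21norm (w n) <= (k + eps)%:E)%E.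
  by move=> eps0; apply: ooU; apply: filterS (uKoo _ eps0) => n; rewrite wDE.
have vD : (D21norm v <= (k + 1)%:E)%E.
  by apply: (D21norm_le_cvg UF wv); exact: wK.
have vp : (lpsum p v <= B%:E)%E.
  apply: (lpsum_le_cvg UF p0 wv); apply: filterS (wK 1 ltr01) => n.
  by rewrite wDE lpsum_translate; exact: uB.
have vq : (lpsum q v <= 1)%E.
  by apply: (lpsum_le_cvg UF q0 wv); apply: nearW => n; rewrite wq.
have vD21 : D21 v.
  split; last by rewrite (le_lt_trans vD)// ltry.
  by apply/(lnorm_lty _ p0); rewrite (le_lt_trans vp)// ltry.
have v0 : c <= `|v 0|.
  apply: (cvgr_to_ge (cvg_norm (wv 0))); apply: filterS (wK 1 ltr01) => n.
  by rewrite wDE /w addr0; exact: x_P.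
have vqfin : (lpsum q v < +oo)%E by rewrite (le_lt_trans vq)// ltry.
have aE := fineK (lpsum_fin_num vqfin).
set a := fine (lpsum q v) in aE.
have a1 : a <= 1 by rewrite -lee_fin aE.
have a0 : 0 < a.
  have := normr_le_lpsum 0 q0 vqfin; rewrite -/a => le.
  rewrite lt_neqAle -lee_fin aE lpsum_ge0 andbT eq_sym; apply/eqP => a0.
  move: (le_trans v0 le); rewrite a0 powR0 ?invr_eq0 ?gt_eqF//.
  by rewrite leNgt c0.
have vDfin : D21norm v \is a fin_num.
  by rewrite ge0_fin_numE ?D21norm_ge0//; case: vD21.
have dE := fineK vDfin; set d := fine (D21norm v) in dE.
have kd : k * a `^ q^-1 <= d.
  by rewrite -lee_fin dE; apply: (Ktilde_le hN hq kE vD21); rewrite aE.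
pose z n x := w n x - v x.
have zD n : D21 (z n) by exact: D21B.
have zsplit (eps : R) : 0 < eps ->
    \forall n \near U, (D21norm (z n) + d%:E <= (k + 2 * eps)%:E)%E.
  move=> eps0; rewrite dE; case: vD21 => _ vDlt.
  apply: filterS (filterI (near_D21norm_split UF wv vDlt eps0) (wK _ eps0)).
  move=> n [le1 le2]; apply: le_trans le1 _.
  have -> : k + 2 * eps = k + eps + eps by lra.
  by rewrite EFinD leeD2r.
have a_eq1 : a = 1.
  apply: (no_dichotomy K1 (lt_trans p1 hq) a0 a1 kd) => eps eps0.
  have c1 : 1 < 1 + eps by rewrite ltrDl.
  have [n [Dn qn]] := @filter_ex _ U UF _
    (filterI (zsplit _ eps0) (near_lpsum_split UF q0 wv vqfin c1 eps0)).
  have [/(lnorm_lty _ p0) zp zDlt] := zD n.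
  have zq := fineK (lpsum_fin_num (lpsum_embed_lty p0 (ltW hq) zp)).
  have ze : (fine (D21norm (z n)))%:E = D21norm (z n).
    by rewrite fineK// ge0_fin_numE// D21norm_ge0.
  exists (fine (lpsum q (z n))), (fine (D21norm (z n))); split.
  - by apply: fine_ge0; exact: lpsum_ge0.
  - by rewrite -lee_fin ze; apply: (Ktilde_le hN hq kE (zD n)).
  - by move: qn; rewrite wq -aE -zq -EFinM -!EFinD lee_fin.
  - by rewrite -lee_fin EFinD ze.
(* With a = 1, kd says k <= d, and zsplit leaves nothing for z n. *)
rewrite a_eq1 powR1 mulr1 in kd.
exists x_, v; split => //.
- apply: (extract_subseq UF ooU (d := fun n => D21norm (z n))) => [n|eps eps0].
    exact: D21norm_ge0.
  have e20 : 0 < eps / 2 by rewrite divr_gt0.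
  apply: filterS (zsplit _ e20) => n.
  have -> : k + 2 * (eps / 2) = eps + k by lra.
  rewrite -leeBrDr// -EFinB => /le_trans; apply; rewrite lee_fin; lra.
- by apply/(lnorm_eq1 _ q0); rewrite -aE a_eq1.
- rewrite kE -dE; congr (_%:E); apply/eqP; rewrite eq_le kd andbT.
  apply/ler_addgt0Pr => eps eps0.
  have e20 : 0 < eps / 2 by rewrite divr_gt0.
  have [n le] := filter_ex (zsplit _ e20).
  have : (d%:E <= (k + 2 * (eps / 2))%:E)%E.
    by apply: le_trans le; rewrite leeDr// D21norm_ge0.
  rewrite lee_fin; lra.
Qed.
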